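(* Let $k\ge 1$ and $p_1,\dots,p_k\ge 1$ be integers, let $s_1,\dots,s_k\ge 0$ be integers, and let $a_{ij}\ge 1$ ($1\le i\le k$, $1\le j\le p_i$) be integers. Let $A(n)$ be a solution sequence of the nested recursion $$A(n)=\sum_{i=1}^k A\Big(n-s_i-\sum_{j=1}^{p_i}A(n-a_{ij})\Big)\qquad (n>c),$$ with positive initial values $A(1),\dots,A(c)$, where the solution is well defined for all $n$ (i.e. every argument appearing on the right-hand side is a positive integer). Suppose that $A(n)/n$ converges to a limit $L\neq 0$ as $n\to\infty$. Then $$L=\frac{k-1}{\sum_{i=1}^k p_i}.$$ In particular, if $k=2$ and $p_1=p_2=p$, then $L=\frac{1}{2p}$. *)

(* Defs.v *)
From mathcomp Require Import all_boot all_order all_algebra.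
From mathcomp Require Import all_classical all_reals all_analysis.
Import numFieldNormedType.Exports.

Set Implicit Arguments.
Unset Strict Implicit.
Unset Printing Implicit Defensive.

Import Order.TTheory GRing.Theory Num.Theory.

Local Open Scope ring_scope.

(* A sequence A(1), A(2), ... of integers is represented by A : int -> int, so
   that index subtractions are genuine ones (no truncation); the values of A at
   nonpositive indices are unconstrained and never used. *)
Definition nested_arg (k : nat) (p s : 'I_k -> nat)
    (a : forall i : 'I_k, 'I_(p i) -> nat) (A : int -> int)
    (i : 'I_k) (n : int) : int :=
  n - (s i)%:Z - \sum_(j < p i) A (n - (a i j)%:Z).

Definition well_defined_at (k : nat) (p s : 'I_k -> nat)
    (a : forall i : 'I_k, 'I_(p i) -> nat) (A : int -> int) (n : int) : Prop :=
  (forall (i : 'I_k) (j : 'I_(p i)), 0 < n - (a i j)%:Z) /\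
  (forall i : 'I_k, 0 < nested_arg s a A i n).

Definition nested_solution (k : nat) (p s : 'I_k -> nat)
    (a : forall i : 'I_k, 'I_(p i) -> nat) (c : nat) (A : int -> int) : Prop :=
  [/\ forall n : int, 1 <= n <= c%:Z -> 0 < A n,
      forall n : int, c%:Z < n -> well_defined_at s a A n
    & forall n : int, c%:Z < n -> A n = \sum_(i < k) A (nested_arg s a A i n)].

(* Main.v *)
(* Writing A(m) = L m + o(m) + O(1) uniformly in m >= 0, one gets
   A(N(n))/n -> L l as soon as N(n)/n -> l, even when l = 0 and N(n) stays
   bounded.  Hence the i-th argument divided by n tends to 1 - p_i L, and dividing
   the recursion by n yields L = \sum_i L (1 - p_i L). *)

Require Import Defs.
From mathcomp Require Import all_boot all_order all_algebra.
From mathcomp Require Import all_classical all_reals all_analysis.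
Import numFieldNormedType.Exports.

Set Implicit Arguments.
Unset Strict Implicit.
Unset Printing Implicit Defensive.

Import Order.TTheory GRing.Theory Num.Theory.

Local Open Scope classical_set_scope.
Local Open Scope ring_scope.

Lemma cvg_invn0 (R : realType) : (fun n : nat => n%:R^-1 : R) @ \oo --> (0 : R).
Proof. by rewrite -cvg_shiftS; exact: cvg_harmonic. Qed.

(** Beyond some rank the limit alone gives the bound [e * m%:R]; the finitely many earlier terms are
    absorbed into [C]. Since no rank restricts [m], any index may be substituted for it, even one
    that does not grow. *)
Lemma cvg_ratio_affine_bound (R : realType) (u : nat -> R) (L e : R) :
  (fun n : nat => u n / n%:R) @ \oo --> L -> 0 < e ->
  exists C, forall m, `|u m - L * m%:R| <= e * m%:R + C.
Proof.
move=> /cvgrPdist_le uL e0; have [M _ hM] := uL e e0.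
(* This sum of nonnegative deviations dominates each deviation of index at most [M]. *)
exists (\sum_(m < M.+1) `|u m - L * m%:R|) => m.
have [mM|Mm] := leqP m M.
  rewrite (bigD1 (Ordinal (mM : (m < M.+1)%N)))//=.
  rewrite addrCA lerDl addr_ge0 ?sumr_ge0//.
  by rewrite mulr_ge0 ?ler0n// ltW.
rewrite -[leLHS]addr0 lerD ?sumr_ge0//.
have m0 : (0 : R) < m%:R by rewrite ltr0n (leq_ltn_trans _ Mm).
have h : `|L - u m / m%:R| <= e := hM m (ltnW Mm).
apply: le_trans (_ : `|L - u m / m%:R| * m%:R <= _); last by rewrite ler_pM2r.
rewrite -{3}(gtr0_norm m0) -normrM mulrBl divfK ?gt_eqF//.
by rewrite distrC.
Qed.

Lemma cvg_ratio_comp (R : realType) (u : nat -> R) (N : nat -> nat) (L l : R) :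
  (fun n : nat => u n / n%:R) @ \oo --> L ->
  (fun n : nat => (N n)%:R / n%:R : R) @ \oo --> l ->
  (fun n : nat => u (N n) / n%:R) @ \oo --> L * l.
Proof.
move=> uL Nl.
(* The main part [L * (N n)%:R / n%:R] tends to [L * l], so only the error has to vanish. *)
suff w0 : (fun n => (u (N n) - L * (N n)%:R) / n%:R) @ \oo --> (0 : R).
  rewrite -[L * l]add0r.
  have -> : (fun n => u (N n) / n%:R) =
      (fun n => (u (N n) - L * (N n)%:R) / n%:R + L * ((N n)%:R / n%:R)).
    by apply/funext => n; rewrite mulrA -mulrDl subrK.
  by apply: cvgD => //; apply: cvgMr.
apply/cvgr0Pnorm_le => e e0.
(* [K] eventually bounds [(N n)%:R / n%:R]. With slope [e / 2 / K] the linear part of the error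
   costs at most [e / 2], and [C / n] takes the other half. *)
pose K := `|l| + 1.
have K0 : 0 < K by rewrite ltr_wpDl.
have e'0 : 0 < e / 2 / K by rewrite !divr_gt0.
have [C hC] := cvg_ratio_affine_bound uL e'0.
have Cn0 : (fun n : nat => C * n%:R^-1) @ \oo --> (0 : R).
  by rewrite -[0](mulr0 C); apply: cvgMr; exact: cvg_invn0.
near=> n.
have NK : (N n)%:R / n%:R <= K.
  have : `|l - (N n)%:R / n%:R| <= 1.
    by near: n; move/cvgrPdist_le : Nl; apply.
  rewrite distrC => /(le_trans (ler_norm _)); rewrite lerBlDl => /le_trans; apply.
  by rewrite lerD2r ler_norm.
have Cn : C * n%:R^-1 <= e / 2.
  apply: le_trans (ler_norm _) _.
  by near: n; move/cvgr0Pnorm_le : Cn0; apply; rewrite divr_gt0.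
rewrite normrM (@ger0_norm _ n%:R^-1) ?invr_ge0 ?ler0n//.
have := ler_wpM2r (_ : 0 <= n%:R^-1) (hC (N n)).
rewrite invr_ge0 ler0n => /(_ isT) /le_trans; apply.
rewrite mulrDl -(mulrA (e / 2 / K)) [leRHS]splitr lerD//.
by rewrite -[leRHS](divfK (lt0r_neq0 K0)) (ler_pM2l e'0).
Unshelve. all: by end_near. Qed.

Lemma cvg_subn_ratio (R : realType) (b : nat) :
  (fun n : nat => (n - b)%:R / n%:R : R) @ \oo --> (1 : R).
Proof.
have : (fun n : nat => 1 - b%:R * n%:R^-1 : R) @ \oo --> (1 - b%:R * 0 : R).
  by apply: cvgB; [exact: cvg_cst|apply: cvgMr; exact: cvg_invn0].
rewrite mulr0 subr0; apply: cvg_trans; apply: near_eq_cvg; near=> n.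
have bn : (b < n)%N by near: n; exact: nbhs_infty_gt.
have n0 : n%:R != 0 :> R by rewrite pnatr_eq0 -lt0n (leq_ltn_trans _ bn).
by rewrite natrB ?(ltnW bn)// mulrBl divff.
Unshelve. all: by end_near. Qed.

Theorem theorem2p1 (R : realType) (k : nat) (p s : 'I_k -> nat)
    (a : forall i : 'I_k, 'I_(p i) -> nat) (c : nat) (A : int -> int) (L : R)
    (hk : (1 <= k)%N)
    (hp : forall i : 'I_k, (1 <= p i)%N)
    (ha : forall (i : 'I_k) (j : 'I_(p i)), (1 <= a i j)%N)
    (hA : nested_solution s a c A)
    (hlim : (fun n : nat => (A n%:Z)%:~R / n%:R : R) @ \oo --> L)
    (hL : L != 0) :
  L = (k%:R - 1) / (\sum_(i < k) p i)%N%:R /\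
  (forall q : nat, k = 2%N -> (forall i : 'I_k, p i = q) ->
     L = 1 / (2 * q%:R)).
Proof.
have [_ wd rec] := hA.
pose u (n : nat) : R := (A n%:Z)%:~R.
(* Once [n] reaches [a i j], the integer index equals the truncated [n - a i j], whose ratio to [n]
   tends to 1. *)
have shift i (j : 'I_(p i)) :
    (fun n : nat => (A (n%:Z - (a i j)%:Z))%:~R / n%:R : R) @ \oo --> L.
  have := cvg_ratio_comp (u := u) hlim (@cvg_subn_ratio R (a i j)).
  rewrite mulr1; apply: cvg_trans; apply: near_eq_cvg; near=> n.
  by rewrite /u subzn//; near: n; exact: nbhs_infty_ge.
(* [absz] turns the argument into a natural index for [cvg_ratio_comp]; for [n > c] well-definedness
   makes the argument positive, so its value is unchanged. *)
have arg i : (fun n : nat => (absz (nested_arg s a A i n%:Z))%:R / n%:R : R)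
    @ \oo --> 1 - (p i)%:R * L.
  have H : (fun n : nat => 1 - (s i)%:R * n%:R^-1
        - \sum_(j < p i) (A (n%:Z - (a i j)%:Z))%:~R / n%:R : R)
      @ \oo --> 1 - (s i)%:R * 0 - \sum_(j < p i) L.
    apply: cvgB.
      by apply: cvgB; [exact: cvg_cst|apply: cvgMr; exact: cvg_invn0].
    by apply: cvg_big => [|j _]; [exact: add_continuous|exact: shift].
  rewrite mulr0 subr0 sumr_const card_ord -[L *+ _]mulr_natl in H.
  move: H; apply: cvg_trans; apply: near_eq_cvg; near=> n.
  have cn : (c < n)%N by near: n; exact: nbhs_infty_gt.
  have n0 : n%:R != 0 :> R by rewrite pnatr_eq0 -lt0n (leq_ltn_trans _ cn).
  have [_ /(_ i) pos] := wd n%:Z cn.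
  rewrite /= [X in _ = X / _]pmulrn gtz0_abs//.
  rewrite /nested_arg !rmorphB/= rmorph_sum/= !mulrBl mulr_suml.
  by rewrite -!pmulrn divff.
have E : L = \sum_(i < k) L * (1 - (p i)%:R * L).
  apply: (cvg_unique _ hlim) => //.
  have H : (fun n : nat =>
        \sum_(i < k) u (absz (nested_arg s a A i n%:Z)) / n%:R)
      @ \oo --> \sum_(i < k) L * (1 - (p i)%:R * L).
    by apply: cvg_big => [|i _]; [exact: add_continuous|apply: cvg_ratio_comp].
  move: H; apply: cvg_trans; apply: near_eq_cvg; near=> n.
  have cn : (c < n)%N by near: n; exact: nbhs_infty_gt.
  have [_ pos] := wd n%:Z cn.
  rewrite (rec n%:Z cn) rmorph_sum/= mulr_suml.
  by apply: eq_bigr => i _; rewrite /u gtz0_abs.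
have sp0 : (0 < \sum_(i < k) p i)%N.
  by rewrite (bigD1 (Ordinal hk))//= addn_gt0 hp.
have main : L = (k%:R - 1) / (\sum_(i < k) p i)%N%:R.
  apply: (canRL (mulfK _)); first by rewrite pnatr_eq0 -lt0n.
  (* Cancelling the nonzero [L] leaves the linear equation 1 = k - L * (sum of the [p i]). *)
  move: E; rewrite -mulr_sumr -{1}[L]mulr1 => /(mulfI hL) /eqP.
  rewrite sumrB sumr_const card_ord -mulr_suml -natr_sum eq_sym subr_eq => /eqP ->.
  by rewrite addrAC subrr add0r mulrC.
split=> // q k2 pq; rewrite {1}main (eq_bigr (fun=> q)) => [|i _]; last exact: pq.
(* [2%:R] is convertible to [1 + 1], which lets [addrK] reduce the numerator to 1. *)
by rewrite sum_nat_const card_ord k2 natrM -[2%:R - 1]/(1 + 1 - 1) addrK.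
Unshelve. all: by end_near. Qed.
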